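(* Let $\lambda=e^{2\pi i\omega}$ with $\omega\in\mathbb R\setminus\mathbb Q$, and let $F(z)=\lambda z\bigl(1+f(|z|^2)\bigr)e^{2\pi i g(z)}$ be a germ of analytic diffeomorphism of $(\mathbb R^2,0)$, where $f(u)=\sum_{n\ge1}f_nu^n$ ($f_n\in\mathbb R$) and $g(z)=\sum_{j+k\ge1}g_{jk}z^j\bar z^k$ ($g_{kj}=\overline{g_{jk}}$, not all zero) are real analytic germs. Suppose that $$\rho=\sup_{g_{pq}\neq0}\frac{p-q}{p+q}=\frac NM$$ is a rational number, written as an irreducible fraction $N/M$. For $k\ge1$ let $(p_k,q_k)$ be the pair defined by $p_k+q_k=kM$, $p_k-q_k=kN$, whenever this is a pair of non negative integers, and set $$g^0(Z)=\sum_k g_{p_kq_k}Z^k,\qquad F^0(Z)=\lambda^N Z e^{2\pi i N g^0(Z)},$$ the sum being over those $k\ge1$ for which $(p_k,q_k)$ is a pair of non negative integers. If the holomorphic germ $F^0$ is not holomorphically linearizable, then any formal conjugacy $\Psi$ of $F$ to a normal form is divergent.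
   Context: $\mathbb R^2$ is identified with $\mathbb C$, and (formal or analytic) maps are written as power series in $z,\bar z$. A normal form is a formal map $N(z)=\lambda z\bigl(1+\sum_{k\ge1}\alpha_k|z|^{2k}\bigr)$ with $\alpha_k\in\mathbb C$ (not to be confused with the integer $N$ in $\rho=N/M$). A formal conjugacy of $F$ to a normal form $N$ is a formal diffeomorphism $\Psi(z)=z+\sum_{p+q\ge2}\psi_{pq}z^p\bar z^q$, $\psi_{pq}\in\mathbb C$, such that $\Psi\circ F=N\circ\Psi$. It is divergent if its power series in $(z,\bar z)$ (viewed as two independent variables) converges in no neighborhood of $0$. A holomorphic germ $G(Z)=\mu Z+O(Z^2)$ is holomorphically linearizable if there is a holomorphic germ $h(Z)=Z+O(Z^2)$ with $h\circ G=\mu h$. *)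

(* Defs.v *)
From HB Require Import structures.
From mathcomp Require Import all_boot all_order all_algebra.
From mathcomp Require Import complex.
From mathcomp Require Import boolp classical_sets reals ereal esum trigo.

Set Implicit Arguments.
Unset Strict Implicit.
Unset Printing Implicit Defensive.

Import Order.TTheory GRing.Theory Num.Theory.

Local Open Scope ring_scope.
Local Open Scope complex_scope.
Local Open Scope classical_set_scope.

(* Germs at 0 are identified with their power series: a formal series is its
   family of coefficients, and an analytic (holomorphic) germ is a series
   converging near 0.  [a n] is the coefficient of [Z^n], and [a p q] is the
   coefficient of [z^p zbar^q]. *)
Definition fps1 (K : Type) := nat -> K.
Definition fps2 (K : Type) := nat -> nat -> K.

Section FormalSeries.
Variable K : fieldType.
Implicit Types (c : K) (a b : fps1 K) (A B D : fps2 K).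

Definition one1 : fps1 K := fun n => (n == 0%N)%:R.
Definition varZ : fps1 K := fun n => (n == 1%N)%:R.
Definition scale1 c a : fps1 K := fun n => c * a n.
Definition mul1 a b : fps1 K := fun n => \sum_(i < n.+1) a i * b (n - i)%N.
Definition pow1 a k : fps1 K := iter k (mul1 a) one1.

(* Composition [a (b (Z))] and [exp a]; both are meant for an inner series
   without constant term, whose [i]-th power has no term of degree less than
   [i], so that the truncations below lose nothing. *)
Definition comp1 a b : fps1 K := fun n => \sum_(i < n.+1) a i * pow1 b i n.
Definition exp1 a : fps1 K :=
  fun n => \sum_(i < n.+1) (i`!%:R)^-1 * pow1 a i n.

Definition one2 : fps2 K := fun p q => ((p == 0%N) && (q == 0%N))%:R.
Definition varz : fps2 K := fun p q => ((p == 1%N) && (q == 0%N))%:R.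
Definition add2 A B : fps2 K := fun p q => A p q + B p q.
Definition scale2 c A : fps2 K := fun p q => c * A p q.
Definition mul2 A B : fps2 K := fun p q =>
  \sum_(i < p.+1) \sum_(j < q.+1) A i j * B (p - i)%N (q - j)%N.
Definition pow2 A k : fps2 K := iter k (mul2 A) one2.

(* [exp A] and the substitution [A (B, D)] for [A 0 0 = B 0 0 = D 0 0 = 0]
   (resp. [B 0 0 = D 0 0 = 0]), truncated without loss as above. *)
Definition exp2 A : fps2 K :=
  fun p q => \sum_(i < (p + q).+1) (i`!%:R)^-1 * pow2 A i p q.
Definition subst2 A B D : fps2 K := fun p q =>
  \sum_(i < (p + q).+1) \sum_(j < (p + q).+1)
     A i j * mul2 (pow2 B i) (pow2 D j) p q.

(* The series [a (|z|^2) = a (z zbar)]. *)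
Definition of_sqmod a : fps2 K := fun p q => if p == q then a p else 0.

End FormalSeries.

Section Maps.
Variable R : realType.
Local Notation C := R[i].
Implicit Types (lam : C) (A B Psi : fps2 C) (g : fps2 C).

Definition conj_fps2 A : fps2 C := fun p q => (A q p)^*.

(* Composition of maps of the plane: [z] is replaced by [B], and [zbar] by the
   conjugate of [B]. *)
Definition comp2 A B : fps2 C := subst2 A B (conj_fps2 B).

Definition converges1 (a : fps1 C) : Prop :=
  exists2 r : R, 0 < r & forall z : C, Normc.normc z < r ->
    summable [set: nat]
      (fun n => (Normc.normc (a n * z ^+ n))%:E).

(* The two variables are independent. *)
Definition converges2 A : Prop :=
  exists2 r : R, 0 < r & forall z w : C,
    Normc.normc z < r -> Normc.normc w < r ->
    summable [set: nat * nat]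
      (fun k => (Normc.normc (A k.1 k.2 * z ^+ k.1 * w ^+ k.2))%:E).

Definition divergent A : Prop := ~ converges2 A.

Definition two_pi_i : C := 0 +i* (2 * pi).

(* [e^(2 pi i omega)] *)
Definition rotation (omega : R) : C :=
  cos (2 * pi * omega) +i* sin (2 * pi * omega).

(* [lam z (1 + f(|z|^2)) e^(2 pi i g(z))] *)
Definition mapF lam (f : fps1 R) g : fps2 C :=
  scale2 lam
    (mul2 (mul2 (varz C) (add2 (one2 C) (of_sqmod (fun n => (f n)%:C))))
          (exp2 (scale2 two_pi_i g))).

(* [lam z (1 + sum_(k >= 1) alpha_k |z|^(2k))], when [alpha 0 = 0] *)
Definition normal_form lam (alpha : fps1 C) : fps2 C :=
  scale2 lam (mul2 (varz C) (add2 (one2 C) (of_sqmod alpha))).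

Definition tangent_to_id2 Psi : Prop :=
  [/\ Psi 0%N 0%N = 0, Psi 1%N 0%N = 1 & Psi 0%N 1%N = 0].

Definition formal_conjugacy F lam (alpha : fps1 C) Psi : Prop :=
  tangent_to_id2 Psi /\ comp2 Psi F =2 comp2 (normal_form lam alpha) Psi.

Definition holomorphically_linearizable (G : fps1 C) : Prop :=
  exists h : fps1 C,
    [/\ converges1 h, h 0%N = 0, h 1%N = 1 &
        comp1 h G =1 scale1 (G 1%N) h].

(* Coefficient [k] is [g p q] where [p + q = k M] and [p - q = k N]; the sum
   has at most one term, and is empty when [p], [q] are not natural numbers. *)
Definition g_face (N : int) (M : nat) g : fps1 C := fun k =>
  if k == 0%N then 0 else
  \sum_(p < (k * M).+1 | p%:Z - (k * M - p)%N%:Z == k%:Z * N)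
     g p (k * M - p)%N.

(* [lam^N Z e^(2 pi i N g0(Z))] *)
Definition mapF0 lam (N : int) (M : nat) g : fps1 C :=
  scale1 (lam ^ N)
    (mul1 (varZ C) (exp1 (scale1 (two_pi_i * N%:~R) (g_face N M g)))).

Definition slopes g : set R :=
  [set x | exists p q : nat,
     g p q != 0 /\ x = (p%:R - q%:R) / (p%:R + q%:R)].

End Maps.

(* Main.v *)
From HB Require Import structures.
Require Import Defs.
From mathcomp Require Import all_boot all_order all_algebra.
From mathcomp Require Import complex.
From mathcomp Require Import boolp classical_sets functions cardinality fsbigop.
From mathcomp Require Import reals ereal topology normedtype sequences esum trigo.
From mathcomp Require Import zify ring lra.

(* Give [z^p zbar^q] the weight [(N - M) p + (N + M) q].  All monomials of [g]
   have nonnegative weight, and [|z|^2] has weight [2 N >= 0].  By induction on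
   the degree, since [lambda] is not a root of unity, [Psi] only has monomials
   of weight at least that of [z]; the induction also runs over the weight with
   [z] and [zbar] exchanged, which controls the conjugate of [Psi].  Suppose
   [N > 0] and keep the terms of least weight in the conjugacy equation: from
   [g] there remains [g0(Z)], from the normal form [lambda z], and from [Psi]
   some [z P(Z)] with [P(0) = 1], where [P] converges if [Psi] does.  The
   equation becomes [e^(2 pi i g0) (P o F0) = P], so [h = Z P^N] satisfies
   [h o F0 = lambda^N h].  If [N = 0] then [F0 = Z]. *)

Set Implicit Arguments.
Unset Strict Implicit.
Unset Printing Implicit Defensive.

Import Order.TTheory GRing.Theory Num.Theory.

Local Open Scope ring_scope.

(* [fps2 K] is used below as the ring [fps1 (fps1 K)]. *)
HB.instance Definition _ (R : Type) := gen_eqMixin (fps1 R).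
HB.instance Definition _ (R : Type) := gen_choiceMixin (fps1 R).

(** * The ring of formal power series over a commutative ring *)

Section PsRing.
Variable R : comNzRingType.
Implicit Types a b c : fps1 R.

Definition ps0 : fps1 R := fun=> 0.
Definition ps_opp a : fps1 R := fun n => - a n.
Definition ps_add a b : fps1 R := fun n => a n + b n.

Fact ps_addA : associative ps_add.
Proof. by move=> a b c; apply/funext => n; rewrite /ps_add addrA. Qed.
Fact ps_addC : commutative ps_add.
Proof. by move=> a b; apply/funext => n; rewrite /ps_add addrC. Qed.
Fact ps_add0 : left_id ps0 ps_add.
Proof. by move=> a; apply/funext => n; rewrite /ps_add add0r. Qed.
Fact ps_addN : left_inverse ps0 ps_opp ps_add.
Proof. by move=> a; apply/funext => n; rewrite /ps_add addNr. Qed.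
HB.instance Definition _ :=
  GRing.isZmodule.Build (fps1 R) ps_addA ps_addC ps_add0 ps_addN.

Definition ps1 : fps1 R := fun n => (n == 0%N)%:R.
Definition ps_mul a b : fps1 R := fun n => \sum_(i < n.+1) a i * b (n - i)%N.

(** Coefficient [n] of a product only sees coefficients up to [n], so associativity is read off the
    polynomials truncated at degree [n]. *)
Fact ps_mulA : associative ps_mul.
Proof.
move=> a b c; apply/funext => n; rewrite /ps_mul.
pose A := \poly_(i < n.+1) a i; pose B := \poly_(i < n.+1) b i.
pose D := \poly_(i < n.+1) c i.
have cA i : (i <= n)%N -> A`_i = a i by move=> le_in; rewrite coef_poly ltnS le_in.
have cB i : (i <= n)%N -> B`_i = b i by move=> le_in; rewrite coef_poly ltnS le_in.
have cD i : (i <= n)%N -> D`_i = c i by move=> le_in; rewrite coef_poly ltnS le_in.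
transitivity (A * (B * D))`_n; last rewrite mulrA.
  rewrite coefM; apply: eq_bigr => i _; rewrite coefM cA ?leq_ord //.
  congr (_ * _); apply: eq_bigr => j _.
  by rewrite cB ?cD //; have := ltn_ord i; have := ltn_ord j; lia.
rewrite coefM; apply: eq_bigr => i _; rewrite coefM cD ?leq_subr //.
congr (_ * _); apply: eq_bigr => j _.
by rewrite cA ?cB //; have := ltn_ord i; have := ltn_ord j; lia.
Qed.

Fact ps_mulC : commutative ps_mul.
Proof.
move=> a b; apply/funext => n; rewrite /ps_mul (reindex_inj rev_ord_inj) /=.
by apply: eq_bigr => i _; rewrite subSS subKn ?leq_ord // mulrC.
Qed.

Fact ps_mul1 : left_id ps1 ps_mul.
Proof.
move=> a; apply/funext => n; rewrite /ps_mul big_ord_recl /= mul1r subn0.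
by rewrite big1 ?addr0 // => i _; rewrite mul0r.
Qed.

Fact ps_mulD : left_distributive ps_mul ps_add.
Proof.
move=> a b c; apply/funext => n; rewrite /ps_add -big_split /=.
by apply: eq_bigr => i _; rewrite mulrDl.
Qed.

Fact ps1_neq0 : ps1 != ps0.
Proof.
apply/eqP => /(congr1 (fun a : fps1 R => a 0%N)) /eqP.
by rewrite /ps1 /ps0 eqxx oner_eq0.
Qed.

HB.instance Definition _ :=
  GRing.Zmodule_isComNzRing.Build (fps1 R) ps_mulA ps_mulC ps_mul1 ps_mulD ps1_neq0.

Lemma coef_psM a b n : (a * b) n = \sum_(i < n.+1) a i * b (n - i)%N.
Proof. by []. Qed.

Lemma coef_psD a b n : (a + b) n = a n + b n.
Proof. by []. Qed.

Lemma coef_ps_sum (I : Type) (r : seq I) (P : pred I) (F : I -> fps1 R) n :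
  (\sum_(i <- r | P i) F i) n = \sum_(i <- r | P i) F i n.
Proof. by elim/big_rec2: _ => // i x y _ <-. Qed.

Definition psC (x : R) : fps1 R := fun n => if n == 0%N then x else 0.
Definition psX : fps1 R := fun n => (n == 1%N)%:R.

Lemma coef_psCM x a n : (psC x * a) n = x * a n.
Proof.
rewrite coef_psM big_ord_recl /= subn0 big1 ?addr0 // => i _.
by rewrite /psC /= mul0r.
Qed.

Lemma coef_psXM a n : (psX * a) n = if n is m.+1 then a m else 0.
Proof.
rewrite coef_psM; case: n => [|n]; first by rewrite big_ord1 mul0r.
rewrite big_ord_recl mul0r add0r big_ord_recl /= mul1r subSS subn0.
by rewrite big1 ?addr0 // => i _; rewrite mul0r.
Qed.

Lemma coef_psXnM a i n :
  (psX ^+ i * a) n = if (i <= n)%N then a (n - i)%N else 0.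
Proof.
elim: i n => [|i IHi] n; first by rewrite expr0 mul1r subn0.
by rewrite exprS -mulrA coef_psXM; case: n => // n; rewrite IHi.
Qed.

Lemma psCM : {morph psC : x y / x * y}.
Proof. by move=> x y; apply/funext=> -[|n]; rewrite coef_psCM // mulr0. Qed.

Lemma psCX x k : psC x ^+ k = psC (x ^+ k).
Proof.
elim: k => [|k IHk]; last by rewrite !exprS psCM IHk.
by rewrite !expr0; apply/funext=> -[].
Qed.

Lemma coef0_psM a b : (a * b) 0%N = a 0%N * b 0%N.
Proof. by rewrite coef_psM big_ord1. Qed.

Lemma coef0_psX a k : (a ^+ k) 0%N = a 0%N ^+ k.
Proof. by elim: k => // k IHk; rewrite !exprS coef0_psM IHk. Qed.

Lemma coef_psX_small a k n : a 0%N = 0 -> (n < k)%N -> (a ^+ k) n = 0.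
Proof.
move=> a0; elim: k n => // k IHk n lt_nk; rewrite exprS coef_psM.
apply: big1 => -[[|i] lt_i] _ /=; first by rewrite a0 mul0r.
by rewrite IHk ?mulr0 //; lia.
Qed.

End PsRing.

(** * Composition of series in one variable *)

Section OneVariable.
Variable K : fieldType.
Implicit Types a b c : fps1 K.

Lemma mul1E a b : mul1 a b = a * b. Proof. by []. Qed.
Lemma varZE : varZ K = psX K. Proof. by []. Qed.
Lemma pow1E a k : pow1 a k = a ^+ k.
Proof. by elim: k => // k IHk; rewrite exprS -IHk. Qed.
Lemma scale1E x a : scale1 x a = psC x * a.
Proof. by apply/funext => n; rewrite coef_psCM. Qed.

(** Since [c ^+ i] starts in degree [i], any truncation bound beyond [n] gives the same coefficient.
    Composition thus becomes polynomial evaluation in the ring of series, where multiplicativity is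
    known. *)
Lemma comp1_poly a c m n : c 0%N = 0 -> (n < m)%N ->
  comp1 a c n = (\poly_(i < m) psC (a i)).[c] n.
Proof.
move=> c0 lt_nm; rewrite horner_poly coef_ps_sum /comp1.
rewrite (big_ord_widen_cond m xpredT (fun i => a i * pow1 c i n)) //.
rewrite big_mkcond /=; apply: eq_bigr => i _; rewrite coef_psCM pow1E.
by case: ltnP => // lt_ni; rewrite coef_psX_small ?mulr0.
Qed.

Lemma comp1M a b c : c 0%N = 0 -> comp1 (a * b) c = comp1 a c * comp1 b c :> fps1 K.
Proof.
move=> c0; apply/funext => n.
pose A := \poly_(i < n.+1) psC (a i); pose B := \poly_(i < n.+1) psC (b i).
have -> : (comp1 a c * comp1 b c : fps1 K) n = (A * B).[c] n.
  rewrite hornerM !coef_psM; apply: eq_bigr => i _.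
  by rewrite (@comp1_poly _ _ n.+1) // (@comp1_poly _ _ n.+1) // ltnS leq_subr.
rewrite (@comp1_poly _ _ n.+1) // horner_poly.
rewrite (@horner_coef_wide _ (n.+1 + size (A * B)) _ _ (leq_addl _ _)).
rewrite big_split_ord /= coef_psD !coef_ps_sum /=.
(* Beyond degree [n] the coefficients of [A * B] are distorted by the truncation, but they multiply
   powers of [c] that vanish up to degree [n]. *)
rewrite [X in _ = _ + X]big1 ?addr0; last first.
  move=> i _; rewrite coef_psM big1 // => j _.
  by rewrite (coef_psX_small c0) ?mulr0 //; have := ltn_ord j; lia.
apply: eq_bigr => i _ /=.
suff -> : (A * B)`_i = psC ((a * b) i) by [].
rewrite coefM; apply/funext => m; rewrite coef_ps_sum.
transitivity (\sum_(j < i.+1) psC (a j * b (i - j)%N) m).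
  apply: eq_bigr => j _; rewrite !coef_poly psCM.
  have -> : (j < n.+1)%N by have := ltn_ord i; have := ltn_ord j; lia.
  by have -> : (i - j < n.+1)%N by have := ltn_ord i; lia.
by rewrite /psC; case: m => [|m] /=; rewrite ?big1_eq.
Qed.

Lemma comp1_1 c : comp1 (1 : fps1 K) c = 1 :> fps1 K.
Proof.
apply/funext => n; rewrite /comp1 big_ord_recl big1 ?addr0; last first.
  by move=> i _; rewrite mul0r.
by rewrite mul1r.
Qed.

Lemma comp1_exp a c k : c 0%N = 0 -> comp1 (a ^+ k) c = (comp1 a c : fps1 K) ^+ k.
Proof.
move=> c0; elim: k => [|k IHk]; first by rewrite !expr0 comp1_1.
by rewrite !exprS comp1M // IHk.
Qed.

Lemma comp1_X c : c 0%N = 0 -> comp1 (psX K) c = c.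
Proof.
move=> c0; apply/funext => n; rewrite (@comp1_poly _ _ n.+2) //.
rewrite horner_poly coef_ps_sum big_ord_recl coef_psCM mul0r add0r.
rewrite big_ord_recl coef_psCM mul1r /= big1 ?addr0 // => i _.
by rewrite coef_psCM mul0r.
Qed.

End OneVariable.

(** * Exponentials of multiples of a series *)

Section Exponential.
Variable K : numFieldType.
Implicit Types (a : fps1 K) (x y : K).

(** The series of [e^(x T)] in the variable [T]. Its addition law is the binomial formula, and
    composition transports it to [exp1]. *)
Definition expseries x : fps1 K := fun n => (n`!%:R)^-1 * x ^+ n.

Lemma expseriesD x y : expseries (x + y) = expseries x * expseries y.
Proof.
apply/funext => n; rewrite coef_psM /expseries addrC exprDn mulr_sumr.
apply: eq_bigr => i _; have le_in : (i <= n)%N by rewrite -ltnS.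
have fact_neq0 m : m`!%:R != 0 :> K by rewrite pnatr_eq0 -lt0n fact_gt0.
have /(congr1 (fun m => m%:R : K)) := bin_fact le_in.
rewrite !natrM -mulr_natl => <-.
by field; rewrite !fact_neq0 pnatr_eq0 -lt0n bin_gt0 le_in.
Qed.

Lemma exp1_scale x a : exp1 (scale1 x a) = comp1 (expseries x) a.
Proof.
apply/funext => n; apply: eq_bigr => i _.
by rewrite !pow1E scale1E exprMn psCX coef_psCM mulrA.
Qed.

Lemma exp1_scaleD x y a : a 0%N = 0 ->
  exp1 (scale1 (x + y) a) = exp1 (scale1 x a) * exp1 (scale1 y a).
Proof. by move=> a0; rewrite !exp1_scale expseriesD comp1M. Qed.

Lemma exp1_scale0 a : exp1 (scale1 0 a) = 1.
Proof.
rewrite exp1_scale -(comp1_1 a); congr (comp1 _ a).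
by apply/funext=> -[|n]; rewrite /expseries ?expr0 ?fact0 ?invr1 ?mulr1 // expr0n mulr0.
Qed.

Lemma exp1_scaleMn x a k : a 0%N = 0 ->
  exp1 (scale1 (x * k%:R) a) = exp1 (scale1 x a) ^+ k.
Proof.
move=> a0; elim: k => [|k IHk]; first by rewrite mulr0 exp1_scale0.
by rewrite mulrSr mulrDr mulr1 exp1_scaleD // IHk exprSr.
Qed.

End Exponential.

(** * Series in two variables and weights of their monomials *)

Section TwoVariables.
Variable K : fieldType.
Local Notation ps2 := (fps1 (fps1 K)).
Implicit Types A B D : ps2.

Definition psY : ps2 := psC (psX K).

Lemma coef_ps2M A B p q :
  (A * B) p q = \sum_(i < p.+1) \sum_(j < q.+1) A i j * B (p - i)%N (q - j)%N.
Proof. by rewrite coef_psM coef_ps_sum. Qed.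

Lemma mul2E A B : mul2 A B = A * B.
Proof. by apply/funext => p; apply/funext => q; rewrite coef_ps2M. Qed.

Lemma one2E : one2 K = 1 :> ps2.
Proof. by apply/funext => -[|p]; apply/funext => -[|q]. Qed.

Lemma pow2E A k : pow2 A k = A ^+ k.
Proof.
elim: k => [|k IHk]; first exact: one2E.
by rewrite exprS -IHk -mul2E.
Qed.

Lemma varzE : varz K = psX (fps1 K) :> ps2.
Proof. by apply/funext => -[|[|p]]; apply/funext => -[|q]. Qed.

Lemma add2E A B : add2 A B = A + B. Proof. by []. Qed.

Lemma scale2E x A : scale2 x A = psC (psC x) * A.
Proof.
by apply/funext => p; apply/funext => q; rewrite coef_psCM coef_psCM.
Qed.

Lemma coef_psXYM A i j p q :
  (psX (fps1 K) ^+ i * psY ^+ j * A) p q =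
  if (i <= p)%N && (j <= q)%N then A (p - i)%N (q - j)%N else 0.
Proof.
rewrite -mulrA coef_psXnM; case: leqP => //= _.
by rewrite psCX coef_psCM coef_psXnM.
Qed.

Lemma coef00_ps2X A k : (A ^+ k) 0%N 0%N = A 0%N 0%N ^+ k.
Proof. by rewrite coef0_psX coef0_psX. Qed.

Lemma exp2_00 A : exp2 A 0%N 0%N = 1.
Proof. by rewrite /exp2 big_ord1 /= fact0 invr1 mul1r. Qed.

Implicit Types (u v c : int).

(* Only the monomials of degree less than [d] are constrained. *)
Definition weight_ge u v c d A := forall p q,
  (p + q < d)%N -> A p q != 0 -> c <= u * p%:Z + v * q%:Z.

Lemma weight_geP u v c d A :
  (forall p q, (p + q < d)%N -> u * p%:Z + v * q%:Z < c -> A p q = 0) <->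
  weight_ge u v c d A.
Proof.
split=> HA p q lt_d; first by apply: contra_neqT; rewrite -ltNge; exact: HA.
by rewrite ltNge; apply: contraNeq; apply: HA.
Qed.

(** When neither factor has a constant term, a monomial of degree at most [d] in the product comes
    from monomials of degree less than [d] in both. The induction on the degree of [Psi] rests on
    this gain of one degree. *)
Lemma weight_geM_ord u v c c' d A B : A 0%N 0%N = 0 -> B 0%N 0%N = 0 ->
  weight_ge u v c d A -> weight_ge u v c' d B ->
  weight_ge u v (c + c') d.+1 (A * B).
Proof.
move=> A0 B0 HA HB; apply/weight_geP => p q lt_d lt_c; rewrite coef_ps2M.
rewrite big1 // => -[i lt_i] _; rewrite big1 // => -[j lt_j] _ /=.
apply/eqP; rewrite mulf_eq0 -[_ || _]negbK negb_or; apply/negP => /andP[nA nB].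
have ij_gt0 : (0 < i + j)%N.
  rewrite lt0n; apply: contra nA; rewrite addn_eq0 => /andP[/eqP-> /eqP->].
  exact/eqP.
have kl_gt0 : (0 < (p - i) + (q - j))%N.
  rewrite lt0n; apply: contra nB; rewrite addn_eq0 => /andP[/eqP-> /eqP->].
  exact/eqP.
have := HA i j _ nA; have := HB (p - i)%N (q - j)%N _ nB.
rewrite -!subzn // => hB hA.
have {}hA := hA ltac:(lia); have {}hB := hB ltac:(lia).
by lia.
Qed.

Lemma weight_geM u v c c' d A B :
  weight_ge u v c d A -> weight_ge u v c' d B -> weight_ge u v (c + c') d (A * B).
Proof.
move=> HA HB; apply/weight_geP => p q lt_d lt_c; rewrite coef_ps2M.
rewrite big1 // => -[i lt_i] _; rewrite big1 // => -[j lt_j] _ /=.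
apply/eqP; rewrite mulf_eq0 -[_ || _]negbK negb_or; apply/negP => /andP[nA nB].
have := HA i j _ nA; have := HB (p - i)%N (q - j)%N _ nB.
rewrite -!subzn // => hB hA.
have {}hA := hA ltac:(lia); have {}hB := hB ltac:(lia).
by lia.
Qed.

Lemma weight_ge1 u v d : weight_ge u v 0 d 1.
Proof. by move=> [|p] [|q] _; rewrite ?eqxx // !mulr0. Qed.

Lemma weight_geD u v c d A B :
  weight_ge u v c d A -> weight_ge u v c d B -> weight_ge u v c d (A + B).
Proof.
move=> /weight_geP HA /weight_geP HB; apply/weight_geP => p q lt_d lt_c.
by rewrite coef_psD coef_psD HA ?HB ?addr0.
Qed.

Lemma weight_geX u v c d A k :
  weight_ge u v c d A -> weight_ge u v (c * k%:Z) d (A ^+ k).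
Proof.
move=> HA; elim: k => [|k IHk]; first by rewrite mulr0; exact: weight_ge1.
by rewrite exprS intS mulrDr mulr1; exact: weight_geM.
Qed.

Lemma weight_ge_exp2 u v d A :
  weight_ge u v 0 d A -> weight_ge u v 0 d (exp2 A).
Proof.
move=> HA; apply/weight_geP => p q lt_d lt_c; rewrite /exp2 big1 // => i _.
have := weight_geX (k := i) HA; rewrite mul0r => /weight_geP HAi.
by rewrite pow2E HAi ?mulr0.
Qed.

Lemma weight_ge_sqmod u v d (a : fps1 K) :
  0 <= u + v -> weight_ge u v 0 d (of_sqmod a).
Proof.
move=> uv_ge0 p q _; rewrite /of_sqmod.
case: (p =P q) => [<- _|_]; last by rewrite eqxx.
by rewrite -mulrDl mulr_ge0.
Qed.

Lemma weight_ge_scale u v c d x A :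
  weight_ge u v c d A -> weight_ge u v c d (scale2 x A).
Proof.
move=> /weight_geP HA; apply/weight_geP => p q lt_d lt_c.
by rewrite /scale2 HA ?mulr0.
Qed.

End TwoVariables.

(** * Lower bound for the weights in a formal conjugacy *)

Section Conjugacy.
Variable K : fieldType.
Local Notation ps2 := (fps1 (fps1 K)).
Implicit Types (A B Psi Psib U V : ps2) (u v : int) (lam mu : K).

(** [F] will be [rescaleX lam U] and its conjugate [rescaleY lam^-1 V], with [U] and [V] of constant
    term 1. *)
Definition rescaleX lam U : ps2 := psC (psC lam) * (psX _ * U).
Definition rescaleY lam U : ps2 := psC (psC lam) * (psY K * U).

(** The factor [z^i zbar^j] comes out of the powers of the two arguments, so the terms with [i > p]
    or [j > q] drop out and the others only involve [U ^+ i * V ^+ j]. *)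
Lemma subst2_rescale A lam mu U V p q :
  subst2 A (rescaleX lam U) (rescaleY mu V) p q =
  \sum_(i < p.+1) \sum_(j < q.+1) A i j *
     (lam ^+ i * mu ^+ j * (U ^+ i * V ^+ j) (p - i)%N (q - j)%N).
Proof.
have termE i j : mul2 (pow2 (rescaleX lam U) i) (pow2 (rescaleY mu V) j) p q =
    if (i <= p)%N && (j <= q)%N
    then lam ^+ i * mu ^+ j * (U ^+ i * V ^+ j) (p - i)%N (q - j)%N else 0.
  rewrite mul2E !pow2E /rescaleX /rescaleY !exprMn !(psCX (psC _)) (psCX lam) (psCX mu).
  have -> : psC (psC (lam ^+ i)) * (psX (fps1 K) ^+ i * U ^+ i) *
      (psC (psC (mu ^+ j)) * (psY K ^+ j * V ^+ j)) =
      psC (psC (lam ^+ i * mu ^+ j)) *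
      (psX (fps1 K) ^+ i * psY K ^+ j * (U ^+ i * V ^+ j)).
    by rewrite !psCM; ring.
  rewrite coef_psCM coef_psCM coef_psXYM.
  by case: ifP => // _; rewrite mulr0.
rewrite /subst2.
rewrite (big_ord_widen (p + q).+1 (fun i => \sum_(j < q.+1) A i j *
     (lam ^+ i * mu ^+ j * (U ^+ i * V ^+ j) (p - i)%N (q - j)%N))); last by lia.
rewrite [RHS]big_mkcond /=; apply: eq_bigr => i _.
have [le_ip | lt_pi] := ltnP; last first.
  by rewrite big1 // => j _; rewrite termE leqNgt lt_pi mulr0.
rewrite (big_ord_widen (p + q).+1 (fun j => A i j *
     (lam ^+ i * mu ^+ j * (U ^+ i * V ^+ j) (p - i)%N (q - j)%N))); last by lia.
rewrite [RHS]big_mkcond /=; apply: eq_bigr => j _.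
by rewrite termE -ltnS le_ip ltnS /=; case: (leqP j q) => _; rewrite ?mulr0.
Qed.

Definition normal_form2 lam (alpha : fps1 K) : ps2 :=
  scale2 lam (mul2 (varz K) (add2 (one2 K) (of_sqmod alpha))).

Lemma normal_form2E lam alpha i j : normal_form2 lam alpha i j =
  if i is k.+1 then lam * (((k == 0) && (j == 0))%N%:R + (k == j)%:R * alpha j)
  else 0.
Proof.
rewrite /normal_form2 mul2E varzE /scale2 coef_psXM; case: i => [|i].
  by rewrite mulr0.
rewrite /add2 /one2 /of_sqmod; congr (_ * (_ + _)).
by case: (i =P j) => [->|]; rewrite ?mul1r ?mul0r.
Qed.

(** The monomials of the normal form are [z^(k+1) zbar^k]. Those with [k > 0] contribute through
    [Psi ^+ k.+1 * Psib ^+ k], which vanishes at [(p, q)]; the linear one remains. *)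
Lemma subst2_normal_form lam alpha Psi Psib p q :
  alpha 0%N = 0 -> Psi 0%N 0%N = 0 ->
  (forall k, (0 < k)%N -> (Psi ^+ k.+1 * Psib ^+ k) p q = 0) ->
  subst2 (normal_form2 lam alpha) Psi Psib p q = lam * Psi p q.
Proof.
move=> alpha0 Psi0 Hk; rewrite /subst2.
under eq_bigr do under eq_bigr do rewrite mul2E !pow2E normal_form2E.
have [/eqP | pq_gt0] := posnP (p + q).
  rewrite addn_eq0 => /andP[/eqP-> /eqP->]; rewrite addn0 !big_ord1.
  by rewrite mul0r Psi0 mulr0.
have i1 : (1 < (p + q).+1)%N by [].
rewrite (bigD1 (Ordinal i1)) //= [X in _ + X]big1 ?addr0 => [|i ne_i1].
  rewrite (bigD1 ord0) //= [X in _ + X]big1 ?addr0 => [|j ne_j0].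
    rewrite alpha0 mulr0 addr0 mulr1.
    by rewrite expr1 expr0 mulr1.
  have j_neq0 : (j : nat) == 0%N = false by apply/negbTE.
  by rewrite (eq_sym 0%N) j_neq0 !mul0r addr0 mulr0 mul0r.
apply: big1 => j _.
case: i ne_i1 => -[|[|i]] lt_i; rewrite ?mul0r //= => _.
case: (i.+1 =P j) => [<-|_]; first by rewrite Hk ?mulr0.
by rewrite mul0r addr0 mulr0 mul0r.
Qed.

Lemma resonant_weight u v d Psi Psib k :
  Psi 0%N 0%N = 0 -> Psib 0%N 0%N = 0 ->
  weight_ge u v u d Psi -> weight_ge u v v d Psib -> (0 < k)%N ->
  weight_ge u v (u + (u + v) * k%:Z) d.+1 (Psi ^+ k.+1 * Psib ^+ k).
Proof.
move=> Psi0 Psib0 wPsi wPsib k_gt0.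
have -> : u + (u + v) * k%:Z = u * k.+1%:Z + v * k%:Z by lia.
apply: weight_geM_ord; rewrite ?coef00_ps2X ?Psi0 ?Psib0 ?expr0n ?gtn_eqF //.
- exact: weight_geX.
- exact: weight_geX.
Qed.

Lemma weight_ge_XM u v d U V i j :
  weight_ge u v 0 d U -> weight_ge u v 0 d V ->
  weight_ge u v 0 d (U ^+ i * V ^+ j).
Proof.
move=> wU wV; rewrite -[0 in X in weight_ge _ _ X]addr0.
have wUi := weight_geX (k := i) wU; have wVj := weight_geX (k := j) wV.
by rewrite !mul0r in wUi wVj; exact: weight_geM.
Qed.

(** Consider a monomial of degree at most [d] and weight less than [u]. On the right the nonlinear
    terms weigh at least [u], so [lam * Psi p q] remains; on the left only the term
    [lam ^+ p * mu ^+ q * Psi p q] does. If [Psi p q] is nonzero, then [p = q.+1], and the weight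
    [u + (u + v) q] is at least [u] after all. *)
Lemma conjugacy_support_step u v d Psi Psib U V lam mu alpha :
  0 <= u + v -> alpha 0%N = 0 -> Psi 0%N 0%N = 0 -> Psib 0%N 0%N = 0 ->
  U 0%N 0%N = 1 -> V 0%N 0%N = 1 ->
  (forall e, weight_ge u v 0 e U) -> (forall e, weight_ge u v 0 e V) ->
  subst2 Psi (rescaleX lam U) (rescaleY mu V) =2
    subst2 (normal_form2 lam alpha) Psi Psib ->
  (forall p q, lam ^+ p * mu ^+ q = lam -> p = q.+1) ->
  weight_ge u v u d Psi -> weight_ge u v v d Psib ->
  weight_ge u v u d.+1 Psi.
Proof.
move=> uv_ge0 alpha0 Psi0 Psib0 U0 V0 wU wV conj_eq nonres wPsi wPsib.
apply/weight_geP => p q lt_pq lt_u.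
have := conj_eq p q.
rewrite subst2_normal_form // => [|k k_gt0]; last first.
  have /weight_geP := resonant_weight Psi0 Psib0 wPsi wPsib k_gt0.
  apply=> //; apply: lt_le_trans lt_u _.
  by rewrite lerDl mulr_ge0.
rewrite subst2_rescale (bigD1 ord_max) //= (bigD1 ord_max) //=.
(* The terms of [Psi] of lower degree weigh at least [u], and [U] and [V] only add nonnegative
   weight. *)
have small i j : (i <= p)%N -> (j <= q)%N -> (i != p) || (j != q) ->
    Psi i j * (lam ^+ i * mu ^+ j * (U ^+ i * V ^+ j) (p - i)%N (q - j)%N) = 0.
  move=> le_i le_j ne_ij.
  have [->|nz] := eqVneq (Psi i j) 0; first by rewrite mul0r.
  have le_u : u <= u * i%:Z + v * j%:Z by apply: wPsi nz; lia.
  have /weight_geP -> := @weight_ge_XM u v (p + q).+1 U V i j (wU _) (wV _).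
  - by rewrite !mulr0.
  - by lia.
  - by rewrite -!subzn //; lia.
rewrite !big1 ?addr0 => [|i ne_i|j ne_j]; first last.
- apply: small; rewrite ?leq_ord //; apply/orP; right.
  by apply: contra ne_j => /eqP eq_j; apply/eqP/val_inj.
- apply: big1 => j _; apply: small; rewrite ?leq_ord //; apply/orP; left.
  by apply: contra ne_i => /eqP eq_i; apply/eqP/val_inj.
rewrite !subnn coef0_psM coef0_psM !coef00_ps2X U0 V0 !expr1n !mulr1 mulrC.
have [//|Psi_neq0 /(mulIf Psi_neq0)/nonres p_eq] := eqVneq (Psi p q) 0.
by move: lt_u; rewrite p_eq; have := mulr_ge0 uv_ge0 (ler0n int q); rewrite natz; lia.
Qed.

End Conjugacy.

(** * The part of weight zero of a series *)

Section Face.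
Variables (K : fieldType) (n M : nat).
Hypotheses (n_gt0 : (0 < n)%N) (le_nM : (n <= M)%N) (co_nM : coprime n M).
Local Notation ps2 := (fps1 (fps1 K)).
Implicit Types (A B Psi Psib U V : ps2) (lam mu : K).

Let u : int := n%:Z - M%:Z.
Let v : int := n%:Z + M%:Z.

(* The coefficient of [Z^k] is that of [z^p zbar^q] with [p + q = k M] and
   [p - q = k n], which exist only when [k (M + n)] is even. *)
Definition face A : fps1 K := fun k =>
  if odd (k * (M + n)) then 0 else A (k * (M + n))./2 (k * (M - n))./2.

(** Weight zero means [n (i + j) = M (i - j)]. As [n] and [M] are coprime, [M] divides [i + j], and
    the quotient is [m]. *)
Lemma face_weight i j : u * i%:Z + v * j%:Z = 0 ->
  exists m, [/\ ~~ odd (m * (M + n)), i = (m * (M + n))./2 & j = (m * (M - n))./2].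
Proof.
rewrite /u /v => w0.
have /dvdnP[m ij_eq] : (M %| i + j)%N.
  rewrite -(@Gauss_dvdr _ n) 1?coprime_sym //.
  have le_ji : (j <= i)%N by rewrite leqNgt; apply/negP => lt_ij; nia.
  have -> : (n * (i + j) = M * (i - j))%N by rewrite mulnBr; nia.
  exact: dvdn_mulr.
have m_eq : (i%:Z - j%:Z) = m%:Z * n%:Z.
  have M_gt0 : (0 < M)%N by exact: leq_trans le_nM.
  have M_neq0 : M%:Z != 0 by lia.
  by apply: (mulfI M_neq0); nia.
by exists m; rewrite mulnDr mulnBr; split; nia.
Qed.

(** By [face_weight] the nonzero terms lie at points of the face, and distinct [m] give distinct
    points because [M + n > 0]. *)
Lemma sum_face (G : nat -> nat -> K) k :
  ~~ odd (k * (M + n)) ->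
  (forall i j, (i <= (k * (M + n))./2)%N -> (j <= (k * (M - n))./2)%N ->
    G i j != 0 -> u * i%:Z + v * j%:Z = 0) ->
  \sum_(i < (k * (M + n))./2.+1) \sum_(j < (k * (M - n))./2.+1) G i j =
  \sum_(m < k.+1) face G m.
Proof.
move=> even_k HG; set p := (k * (M + n))./2; set q := (k * (M - n))./2.
pose on m i j := [&& ~~ odd (m * (M + n)), i == (m * (M + n))./2 &
                     j == (m * (M - n))./2].
have le_p m : (m <= k)%N -> ((m * (M + n))./2 <= p)%N.
  by move=> le_m; apply: half_leq; rewrite leq_mul2r le_m orbT.
have le_q m : (m <= k)%N -> ((m * (M - n))./2 <= q)%N.
  by move=> le_m; apply: half_leq; rewrite leq_mul2r le_m orbT.
(* Each nonzero term is attached to exactly one index [m]; the sum over [m] is then moved outside,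
   where it selects one pair [(i, j)] or none. *)
transitivity (\sum_(i < p.+1) \sum_(j < q.+1) \sum_(m < k.+1)
                (if on m i j then G i j else 0)).
  apply: eq_bigr => i _; apply: eq_bigr => j _.
  have [->|nz] := eqVneq (G i j) 0.
    by rewrite big1 // => m _; rewrite if_same.
  have [m [even_m i_eq j_eq]] := face_weight (HG i j (leq_ord i) (leq_ord j) nz).
  have lt_m : (m < k.+1)%N.
    rewrite ltnS leqNgt; apply/negP => lt_km.
    have := leq_ord i; rewrite i_eq /p.
    have : (k.+1 * (M + n) <= m * (M + n))%N by rewrite leq_mul2r lt_km orbT.
    by rewrite mulSn; lia.
  rewrite (bigD1 (Ordinal lt_m)) //= /on even_m i_eq j_eq !eqxx /= big1 ?addr0 //.
  move=> m' ne_m; case: ifP => // /and3P[even_m' /eqP eq_m _]; case/eqP: ne_m.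
  apply: val_inj => /=; have /eqP : (m' * (M + n) = m * (M + n))%N by lia.
  by rewrite eqn_pmul2r ?addn_gt0 ?n_gt0 ?orbT // => /eqP.
under eq_bigr do rewrite exchange_big.
rewrite exchange_big; apply: eq_bigr => m _ /=.
have lt_p : ((m * (M + n))./2 < p.+1)%N by rewrite ltnS le_p ?leq_ord.
have lt_q : ((m * (M - n))./2 < q.+1)%N by rewrite ltnS le_q ?leq_ord.
rewrite (bigD1 (Ordinal lt_p)) //= (bigD1 (Ordinal lt_q)) //= /on /face.
rewrite !eqxx !andbT if_neg !big1 ?addr0 // => [i ne_i|j ne_j].
  rewrite big1 // => j _; case: ifP => // /and3P[_ /eqP eq_i _].
  by case/eqP: ne_i; apply: val_inj.
case: ifP => // /andP[_ /eqP eq_j].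
by case/eqP: ne_j; apply: val_inj.
Qed.

Lemma face_index_weight k : ~~ odd (k * (M + n)) ->
  u * (k * (M + n))./2%:Z + v * (k * (M - n))./2%:Z = 0.
Proof.
move=> even_k; have : odd (k * (M - n)) = odd (k * (M + n)).
  by rewrite !oddM oddB // oddD.
have : (k * n <= k * M)%N by rewrite leq_mul2l le_nM orbT.
by move: even_k; rewrite /u /v mulnBr mulnDr; nia.
Qed.

Lemma face_index_diff k : ~~ odd (k * (M + n)) ->
  ((k * (M + n))./2 = (k * (M - n))./2 + n * k)%N.
Proof.
move=> even_k; have : odd (k * (M - n)) = odd (k * (M + n)).
  by rewrite !oddM oddB // oddD.
have : (k * n <= k * M)%N by rewrite leq_mul2l le_nM orbT.
by move: even_k; rewrite mulnBr mulnDr; lia.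
Qed.

Lemma face_index_sub k m : (m <= k)%N ->
  ~~ odd (k * (M + n)) -> ~~ odd (m * (M + n)) ->
  [/\ ~~ odd ((k - m) * (M + n)),
      ((k * (M + n))./2 - (m * (M + n))./2 = ((k - m) * (M + n))./2)%N &
      ((k * (M - n))./2 - (m * (M - n))./2 = ((k - m) * (M - n))./2)%N].
Proof.
move=> le_m even_k even_m.
have le_mM : (m * (M + n) <= k * (M + n))%N by rewrite leq_mul2r le_m orbT.
have le_mM' : (m * (M - n) <= k * (M - n))%N by rewrite leq_mul2r le_m orbT.
have odd_eq l : odd (l * (M - n)) = odd (l * (M + n)).
  by rewrite !oddM oddB // oddD.
have := odd_eq m; have := odd_eq k; rewrite (negbTE even_k) (negbTE even_m).
by rewrite !mulnBl oddB // (negbTE even_k) (negbTE even_m) => o1 o2; split=> //; lia.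
Qed.

Lemma face_oddM A B k : odd (k * (M + n)) -> (face A * face B) k = 0.
Proof.
move=> odd_k; rewrite coef_psM big1 // => m _; rewrite /face.
case: ifPn => [_|even_m]; first by rewrite mul0r.
have -> : odd ((k - m) * (M + n)).
  by rewrite mulnBl oddB ?leq_mul2r ?leq_ord ?orbT // odd_k (negbTE even_m).
by rewrite mulr0.
Qed.

(** Weights add up and none is negative, so a monomial of weight zero in the product comes from two
    monomials of weight zero. *)
Lemma faceM A B : (forall d, weight_ge u v 0 d A) ->
  (forall d, weight_ge u v 0 d B) -> face (A * B) = face A * face B.
Proof.
move=> wA wB; apply/funext => k.
have [odd_k | even_k] := boolP (odd (k * (M + n))).
  by rewrite face_oddM // /face odd_k.
rewrite coef_psM {1}/face (negbTE even_k) coef_ps2M.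
set p := _./2; set q := _./2.
rewrite (@sum_face (fun i j => A i j * B (p - i)%N (q - j)%N)) //.
  apply: eq_bigr => m _; rewrite /face; case: ifPn => [_|even_m].
    by rewrite mul0r.
  by have [/negbTE-> -> ->] := face_index_sub (leq_ord m) even_k even_m.
move=> i j le_i le_j; rewrite mulf_eq0 negb_or => /andP[nA nB].
have := wA (i + j).+1 i j (leqnn _) nA.
have := wB (p - i + (q - j)).+1 (p - i)%N (q - j)%N (leqnn _) nB.
by rewrite -!subzn //; have := face_index_weight even_k; lia.
Qed.

Lemma face1 : face 1 = 1.
Proof.
apply/funext => -[|k]; first by rewrite /face !mul0n.
rewrite /face; case: ifP => // _.
have : (0 < (k.+1 * (M + n))./2)%N by rewrite half_gt0 mulSn; lia.
by case: _./2.
Qed.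

Lemma faceX A k : (forall d, weight_ge u v 0 d A) -> face (A ^+ k) = face A ^+ k.
Proof.
move=> wA; elim: k => [|k IHk]; first by rewrite !expr0 face1.
rewrite !exprS faceM ?IHk // => d.
by have := weight_geX (k := k) (wA d); rewrite mul0r.
Qed.

End Face.

(** * The conjugacy equation in least weight *)

Section FaceIdentity.
Variables (K : fieldType) (n M : nat).
Hypotheses (n_gt0 : (0 < n)%N) (le_nM : (n <= M)%N) (co_nM : coprime n M).
Local Notation ps2 := (fps1 (fps1 K)).
Implicit Types (A B Psi Psib U V : ps2) (lam mu : K).

Let u : int := n%:Z - M%:Z.
Let v : int := n%:Z + M%:Z.

(** [face] commutes with powers. Only the truncations differ, at [p + q] on one side and at [k] on
    the other, and the powers in between have no term of degree [k]. *)
Lemma face_exp2 A : (forall d, weight_ge u v 0 d A) -> A 0%N 0%N = 0 ->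
  face n M (exp2 A) = exp1 (face n M A).
Proof.
move=> wA A0; have faceA0 : face n M A 0%N = 0 by rewrite /face !mul0n.
apply/funext => k; rewrite /face /exp1.
under [in RHS]eq_bigr do rewrite pow1E -(faceX n_gt0 le_nM co_nM _ wA).
have [odd_k|even_k] := ifPn.
  by rewrite big1 // => i _; rewrite /face odd_k mulr0.
set p := _./2; set q := _./2.
have le_k : (k <= p + q)%N.
  have odd_eq : odd (k * (M - n)) = odd (k * (M + n)).
    by rewrite !oddM oddB // oddD.
  have : (k <= k * M)%N by rewrite leq_pmulr // (leq_trans n_gt0).
  by move: odd_eq even_k; rewrite /p /q mulnBr mulnDr; nia.
rewrite /exp2 (big_ord_widen (p + q).+1
  (fun i => (i`!%:R)^-1 * face n M (A ^+ i) k)) ?ltnS //.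
rewrite [RHS]big_mkcond /=; apply: eq_bigr => i _; rewrite pow2E.
case: ltnP => [_|lt_ki]; first by rewrite /face (negbTE even_k).
have := coef_psX_small faceA0 lt_ki; rewrite -faceX // /face (negbTE even_k).
by move=> ->; rewrite mulr0.
Qed.

Lemma face_sqmod (a : fps1 K) : a 0%N = 0 -> face n M (of_sqmod a) = 0.
Proof.
move=> a0; apply/funext => -[|k]; rewrite /face /of_sqmod; first by rewrite !mul0n a0.
case: ifPn => // even_k; case: eqP => // eq_k.
have : (k.+1 * (M + n) = k.+1 * (M - n) + (k.+1 * n).*2)%N.
  by rewrite -mul2n mulnCA -mulnDr; lia.
have : (0 < k.+1 * n)%N by rewrite muln_gt0.
by lia.
Qed.

Lemma faceD A B : face n M (A + B) = face n M A + face n M B.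
Proof.
by apply/funext => k; rewrite coef_psD /face; case: ifP; rewrite ?addr0.
Qed.

Lemma face_scale x A : face n M (scale2 x A) = scale1 x (face n M A).
Proof.
by apply/funext => k; rewrite /scale1 /face; case: ifP; rewrite ?mulr0.
Qed.

(** Compare the coefficients of [z^(p+1) zbar^q] for [(p, q)] on the face: their weight [u] is the
    least one. On the left [Psi], [U] and [V] then count only through [P], [E] and the inverse of
    [E]. The exponents of [z] and [zbar] on the face differ by [n m], so the powers of [lam] and [E]
    combine into those of the composition. *)
Lemma face_identity Psi Psib U V E lam alpha :
  alpha 0%N = 0 -> Psi 0%N 0%N = 0 -> Psib 0%N 0%N = 0 -> lam != 0 ->
  (forall d, weight_ge u v 0 d U) -> (forall d, weight_ge u v 0 d V) ->
  (forall d, weight_ge u v u d Psi) -> (forall d, weight_ge u v v d Psib) ->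
  subst2 Psi (rescaleX lam U) (rescaleY lam^-1 V) =2
    subst2 (normal_form2 lam alpha) Psi Psib ->
  face n M U = E -> E * face n M V = 1 ->
  let P := face n M (fun p => Psi p.+1) in
  E * comp1 P (scale1 (lam ^+ n) (psX K * E ^+ n)) = P.
Proof.
move=> alpha0 Psi0 Psib0 lam_neq0 wU wV wPsi wPsib conj_eq UE EV P.
have comp_eq k : (E * comp1 P (scale1 (lam ^+ n) (psX K * E ^+ n)) : fps1 K) k =
    \sum_(m < k.+1) P m * (lam ^+ (n * m) * (E ^+ (n * m).+1) (k - m)%N).
  set G := scale1 _ _; have G0 : G 0%N = 0 by rewrite /G /scale1 coef_psXM mulr0.
  transitivity ((E * (\poly_(i < k.+1) psC (P i)).[G]) k).
    rewrite !coef_psM; apply: eq_bigr => i _.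
    by rewrite (@comp1_poly _ _ _ k.+1) // ltnS leq_subr.
  rewrite horner_poly mulr_sumr coef_ps_sum; apply: eq_bigr => m _.
  have -> : E * (psC (P m) * G ^+ m) =
      psC (P m * lam ^+ (n * m)) * (psX K ^+ m * E ^+ (n * m).+1).
    by rewrite /G scale1E !exprMn psCX -!exprM exprS psCM; ring.
  by rewrite coef_psCM coef_psXnM leq_ord mulrA.
apply/funext => k; rewrite comp_eq {comp_eq}.
have Pface m : P m != 0 -> ~~ odd (m * (M + n)).
  by rewrite /P /face; case: ifP; rewrite ?eqxx.
have [odd_k | even_k] := boolP (odd (k * (M + n))).
  rewrite {2}/P /face odd_k big1 // => m _.
  have [->|/Pface even_m] := eqVneq (P m) 0; first by rewrite mul0r.
  rewrite -UE -faceX // /face.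
  have -> : odd ((k - m) * (M + n)).
    by rewrite mulnBl oddB ?leq_mul2r ?leq_ord ?orbT // odd_k (negbTE even_m).
  by rewrite !mulr0.
apply: (mulfI lam_neq0); rewrite mulr_sumr.
set p := (k * (M + n))./2; set q := (k * (M - n))./2.
have wpq : u * p%:Z + v * q%:Z = 0 by exact: face_index_weight.
have v_gt0 : 0 < v by rewrite /v; lia.
have u_le0 : u <= 0 by rewrite /u; lia.
transitivity (lam * Psi p.+1 q); last by rewrite /P /face (negbTE even_k).
(* The nonlinear terms of the normal form exceed the weight [u] by at least [u + v = 2 n > 0]. *)
have := conj_eq p.+1 q; rewrite subst2_normal_form // => [<-|l l_gt0]; last first.
  have /weight_geP :=
    resonant_weight Psi0 Psib0 (wPsi (p + q).+2) (wPsib (p + q).+2) l_gt0.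
  apply; first by lia.
  suff : 0 < (u + v) * l by lia.
  by rewrite mulr_gt0 // /u /v; lia.
have wUV i j p' q' : (U ^+ i * V ^+ j) p' q' != 0 -> 0 <= u * p'%:Z + v * q'%:Z.
  exact: (weight_ge_XM (wU (p' + q').+1) (wV _) (ltnSn _)).
rewrite subst2_rescale [RHS]big_ord_recl.
(* Terms with [i = 0]: for [j > 0] the cofactor would have weight [u - v j < 0], and [Psi 0 0] is
   zero. *)
rewrite [X in _ = X + _]big1 ?add0r => [|j _]; last first.
  apply/eqP; rewrite -[_ == 0]negbK !mulf_eq0 !negb_or.
  apply/negP => /andP[nPsi /andP[_ /wUV]].
  have := wPsi _ _ _ (ltnSn (0 + j)) nPsi.
  rewrite subn0 -subzn ?leq_ord //= => le1 le2.
  case: (posnP j) => [j0|j_gt0]; first by rewrite j0 Psi0 eqxx in nPsi.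
  suff : 0 < v * j by lia.
  by rewrite mulr_gt0.
under [RHS]eq_bigr do rewrite /= /bump /= add1n subSS.
rewrite (@sum_face K n M n_gt0 le_nM co_nM (fun i j => Psi i.+1 j *
   (lam ^+ i.+1 * lam^-1 ^+ j * (U ^+ i.+1 * V ^+ j) (p - i)%N (q - j)%N))) //.
  apply: eq_bigr => m _; rewrite {1}/P /face; case: ifPn => [_|even_m].
    by rewrite mul0r mulr0.
  have [even_km -> ->] := face_index_sub n_gt0 le_nM co_nM (leq_ord m) even_k even_m.
  rewrite (face_index_diff n_gt0 le_nM co_nM even_m); set j := (m * (M - n))./2.
  have wUi i : forall d, weight_ge u v 0 d (U ^+ i).
    by move=> d; have := weight_geX (k := i) (wU d); rewrite mul0r.
  have wVi i : forall d, weight_ge u v 0 d (V ^+ i).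
    by move=> d; have := weight_geX (k := i) (wV d); rewrite mul0r.
  have -> : (U ^+ (j + n * m).+1 * V ^+ j)
      ((k - m) * (M + n))./2 ((k - m) * (M - n))./2 = (E ^+ (n * m).+1) (k - m)%N.
    have <- : face n M (U ^+ (j + n * m).+1 * V ^+ j) = E ^+ (n * m).+1.
      rewrite faceM // !faceX // UE -addnS exprD mulrAC -exprMn EV.
      by rewrite expr1n mul1r.
    by rewrite /face (negbTE even_km).
  have -> : lam ^+ (j + n * m).+1 * lam^-1 ^+ j = lam * lam ^+ (n * m).
    by rewrite -addnS exprD mulrAC -exprMn divff // expr1n mul1r exprS.
  by ring.
(* The weights of [(i, j)] and [(p - i, q - j)] are nonnegative with sum zero, so both vanish. *)
move=> i j le_i le_j; rewrite !mulf_eq0 !negb_or => /and3P[nPsi _ /wUV].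
have := wPsi _ _ _ (ltnSn (i.+1 + j)) nPsi.
by rewrite -!subzn // intS mulrDr; lia.
Qed.

End FaceIdentity.

(** [h] composed with [G] is [G * comp1 P G ^+ k], that is, [c Z (E * comp1 P G) ^+ k = c h]. *)
Lemma linearization (K : fieldType) (P E : fps1 K) (c : K) k :
  let G := scale1 c (psX K * E ^+ k) in
  P 0%N = 1 -> E 0%N = 1 -> E * comp1 P G = P ->
  let h := psX K * P ^+ k in
  [/\ h 0%N = 0, h 1%N = 1 & comp1 h G =1 scale1 (G 1%N) h].
Proof.
move=> G P0 E0 PE h.
have G0 : G 0%N = 0 by rewrite /G /scale1 coef_psXM mulr0.
have G1 : G 1%N = c by rewrite /G /scale1 coef_psXM coef0_psX E0 expr1n mulr1.
split=> [||i].
- by rewrite /h coef_psXM.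
- by rewrite /h coef_psXM coef0_psX P0 expr1n.
rewrite G1 /h comp1M // comp1_X // comp1_exp // -{2}PE exprMn.
by rewrite /G !scale1E -!mulrA.
Qed.

(** * Convergence and geometric growth of coefficients *)

Section Convergence.
Local Open Scope classical_set_scope.
Variable R : realType.
Local Notation C := R[i].
Local Notation normc := (@Normc.normc R).
Implicit Types (a b : fps1 C).

Lemma summable_bounded (T : choiceType) (F : T -> R) :
  summable [set: T] (fun k => (F k)%:E) -> exists B, forall k, F k <= B.
Proof.
rewrite summableE => fin_sum.
exists (fine (\esum_(k in [set: T]) `|(F k)%:E|)%E) => k.
rewrite -lee_fin fineK //; apply: (@le_trans _ _ `|(F k)%:E|%E).
  by rewrite lee_fin ler_norm.
by apply: esum_ge; exists [set k]; rewrite ?fsbig_set1.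
Qed.

Lemma summable_geometric (F : nat -> R) B :
  (forall n, 0 <= F n <= B * 2^-1 ^+ n) ->
  summable [set: nat] (fun n => (F n)%:E).
Proof.
move=> HF; rewrite /summable -nneseries_esumT; last by move=> n; exact: abse_ge0.
apply: (@le_lt_trans _ _ (B * 2)%:E); last exact: ltry.
apply: lime_le; first by apply: is_cvg_nneseries.
apply: nearW => n.
under eq_bigr do rewrite abse_EFin.
rewrite sumEFin lee_fin.
(* The exact value of the geometric sum, remainder included, makes the induction close. *)
suff : \sum_(0 <= i < n) `|F i| <= B * (2 - 2 * 2^-1 ^+ n).
  move=> /le_trans; apply; have /andP[F0 FB] := HF n.
  by have := le_trans F0 FB; lra.
elim: n => [|n IHn]; first by rewrite big_geq // expr0; lra.
rewrite big_nat_recr //= exprS; have /andP[F0 FB] := HF n.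
by rewrite ger0_norm //; lra.
Qed.

Lemma normcX (z : C) n : normc (z ^+ n) = normc z ^+ n.
Proof.
elim: n => [|n IHn]; first by rewrite !expr0 Normc.normc1.
by rewrite !exprS Normc.normcM IHn.
Qed.

Lemma normc_ge0 (z : C) : 0 <= normc z.
Proof. by case: z => x y; rewrite /Normc.normc sqrtr_ge0. Qed.

Lemma normc_real (x : R) : normc x%:C%C = `|x|.
Proof. by rewrite /Normc.normc /= expr0n addr0 sqrtr_sqr. Qed.

Lemma normc_sum (I : Type) (r : seq I) (P : pred I) (F : I -> C) :
  normc (\sum_(i <- r | P i) F i) <= \sum_(i <- r | P i) normc (F i).
Proof.
elim/big_rec2: _ => [|i y x _ le_xy]; first by rewrite Normc.normc0.
exact: le_trans (le_normcD _ _) (lerD (lexx _) le_xy).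
Qed.

(** This coefficient form of a positive radius of convergence is easy to carry through products. *)
Definition geometric_growth a : Prop :=
  exists B b : R, [/\ 0 < B, 0 < b & forall n, normc (a n) <= B * b ^+ n].

(** Each of the [n + 1] terms is at most [B D (s + t)^n], and [n + 1 <= 2^n] accounts for the factor
    2 in the rate. *)
Lemma geometric_growthM a b :
  geometric_growth a -> geometric_growth b -> geometric_growth (a * b).
Proof.
move=> [B [s [B0 s0 Ha]]] [D [t [D0 t0 Hb]]].
have st0 : 0 < s + t by exact: addr_gt0.
exists (B * D), (2 * (s + t)); split; rewrite ?mulr_gt0 // => n.
rewrite coef_psM; apply: le_trans (normc_sum _ _ _) _.
apply: (@le_trans _ _ (\sum_(i < n.+1) B * D * (s + t) ^+ n)).
  apply: ler_sum => i _; rewrite Normc.normcM.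
  apply: le_trans (ler_pM (normc_ge0 _) (normc_ge0 _) (Ha _) (Hb _)) _.
  rewrite mulrACA ler_pM2l ?mulr_gt0 //.
  rewrite -[in leRHS](subnKC (leq_ord i)) exprD.
  by apply: ler_pM; rewrite ?exprn_ge0 ?lerXn2r ?nnegrE ?ltW // ?ltrDl ?ltrDr.
rewrite sumr_const card_ord exprMn -[leLHS]mulr_natl mulrCA.
rewrite ler_pM2l ?mulr_gt0 // ler_pM2r ?exprn_gt0 //.
by rewrite -natrX ler_nat ltn_expl.
Qed.

Lemma geometric_growth_converges a : geometric_growth a -> converges1 a.
Proof.
move=> [B [b [B0 b0 Ha]]]; exists (2 * b)^-1; first by rewrite invr_gt0 mulr_gt0.
move=> z lt_z; apply: (@summable_geometric _ B) => n.
rewrite normc_ge0 Normc.normcM normcX /=.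
have le_bz : b * normc z <= 2^-1.
  rewrite -(ler_pM2l (ltr0n _ 2 : 0 < 2 :> R)) mulrA divff ?pnatr_eq0 //.
  by rewrite -ler_pdivlMl ?mulr_gt0 // mulr1 ltW.
apply: (@le_trans _ _ (B * b ^+ n * normc z ^+ n)).
  by rewrite ler_wpM2r ?exprn_ge0 ?normc_ge0.
rewrite -mulrA -exprMn ler_pM2l //.
apply: lerXn2r; rewrite ?nnegrE ?invr_ge0 ?mulr_ge0 ?normc_ge0 //.
exact: ltW.
Qed.

(** Summability at the single point [z = w = x] bounds [|Psi p q| x^(p+q)]. The linear bound on
    [p k + q k] turns this into growth in [k] at rate [x^-l]. *)
Lemma geometric_growth_subseries (l : nat) (Psi : fps2 C) (p q : nat -> nat) a :
  converges2 Psi -> (forall k, (p k + q k <= l * k.+1)%N) ->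
  (forall k, a k = 0 \/ a k = Psi (p k) (q k)) -> geometric_growth a.
Proof.
move=> [r r0 Hr] le_pq Ha.
(* [x < r] keeps the point in the domain of convergence, and [x <= 1] allows the exponent
   [p k + q k] to be raised to [l (k + 1)]. *)
pose x := Num.min (r / 2) 1.
have x0 : 0 < x by rewrite lt_min divr_gt0 //=.
have x1 : x <= 1 by rewrite ge_min lexx orbT.
have xr : normc x%:C%C < r.
  rewrite normc_real ger0_norm ?ltW // (@le_lt_trans _ _ (r / 2)) //.
    by rewrite ge_min lexx.
  by rewrite ltr_pdivrMr //; lra.
have [B HB] := summable_bounded (Hr _ _ xr xr).
have B_ge0 : 0 <= B by exact: le_trans (normc_ge0 _) (HB (0, 0)%N).
have xl0 m : 0 < x ^- m by rewrite invr_gt0 exprn_gt0.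
exists ((B + 1) * x ^- l), (x ^- l); split=> // [|k].
  by rewrite mulr_gt0 //; lra.
have bound_ge0 : 0 <= (B + 1) * x ^- l * x ^- l ^+ k.
  by rewrite !mulr_ge0 ?exprn_ge0 ?(ltW (xl0 _)) //; lra.
case: (Ha k) => ->; first by rewrite Normc.normc0.
have := HB (p k, q k).
rewrite /= !Normc.normcM !normcX normc_real ger0_norm ?(ltW x0) //.
rewrite -mulrA -exprD => le_B.
have le_x : x ^+ (l * k.+1) <= x ^+ (p k + q k) by rewrite ler_wiXn2l // ltW.
rewrite -mulrA -exprS -exprVn -exprM exprVn -ler_pdivrMr ?xl0 // invrK.
apply: le_trans (_ : _ <= B) _; last by lra.
by apply: le_trans le_B; rewrite ler_wpM2l ?normc_ge0.
Qed.

End Convergence.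

(** * Complex conjugation of series *)

Section Conjugation.
Variable R : realType.
Local Notation C := R[i].
Local Notation ps2 := (fps1 (fps1 C)).
Implicit Types A B : ps2.

Lemma conj_fps2M A B :
  conj_fps2 (A * B) = (conj_fps2 A : ps2) * (conj_fps2 B : ps2) :> ps2.
Proof.
apply/funext => p; apply/funext => q; rewrite coef_ps2M /conj_fps2 coef_ps2M.
rewrite exchange_big rmorph_sum; apply: eq_bigr => i _.
by rewrite rmorph_sum; apply: eq_bigr => j _; rewrite rmorphM.
Qed.

Lemma conj_fps2_1 : conj_fps2 (1 : ps2) = 1 :> ps2.
Proof.
by apply/funext => -[|p]; apply/funext => -[|q]; rewrite /conj_fps2 ?rmorph0 ?rmorph1.
Qed.

Lemma conj_fps2X A k : conj_fps2 (A ^+ k) = (conj_fps2 A : ps2) ^+ k :> ps2.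
Proof.
by elim: k => [|k IHk]; rewrite ?expr0 ?conj_fps2_1 // !exprS conj_fps2M IHk.
Qed.

Lemma conj_fps2D A B :
  conj_fps2 (A + B) = (conj_fps2 A : ps2) + (conj_fps2 B : ps2) :> ps2.
Proof.
by apply/funext => p; apply/funext => q; rewrite /conj_fps2 !coef_psD rmorphD.
Qed.

Lemma conj_exp2 A : conj_fps2 (exp2 A) = exp2 (conj_fps2 A).
Proof.
apply/funext => p; apply/funext => q; rewrite /conj_fps2 /exp2 addnC rmorph_sum.
apply: eq_bigr => i _; rewrite rmorphM fmorphV rmorph_nat !pow2E.
by rewrite -[in RHS]/(conj_fps2 A) -conj_fps2X.
Qed.

Lemma conj_scale2 x A : conj_fps2 (scale2 x A) = scale2 (conjc x) (conj_fps2 A).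
Proof. by apply/funext => p; apply/funext => q; rewrite /conj_fps2 /scale2 rmorphM. Qed.

Lemma conj_psX : conj_fps2 (psX (fps1 C)) = psY C.
Proof.
apply/funext => p; apply/funext => q.
rewrite /conj_fps2 -[psX _]mulr1 coef_psXM.
by case: q p => [|[|q]] [|p]; rewrite ?rmorph0 ?rmorph1.
Qed.

Lemma conj_rescaleX lam A :
  conj_fps2 (rescaleX lam A) = rescaleY (conjc lam) (conj_fps2 A).
Proof.
rewrite /rescaleX /rescaleY -!scale2E conj_scale2; congr scale2.
by rewrite conj_fps2M conj_psX.
Qed.

Lemma weight_ge_conj (u v c : int) d A :
  weight_ge v u c d A -> weight_ge u v c d (conj_fps2 A).
Proof.
move=> wA p q lt_d nz; rewrite addrC; apply: wA; first by rewrite addnC.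
by apply: contra nz => /eqP A0; rewrite /conj_fps2 A0 rmorph0.
Qed.

End Conjugation.

(** * Powers of the multiplier *)

Section Rotation.
Variable R : realType.
Implicit Types w : R.

Lemma rotationD w1 w2 : rotation (w1 + w2) = rotation w1 * rotation w2.
Proof.
rewrite /rotation mulrDr cosD sinD; apply/eqP; rewrite eq_complex /=.
by rewrite addrC [X in _ == X]addrC [X in X == _]addrC eqxx /= addrC.
Qed.

Lemma rotation0 : rotation (0 : R) = 1.
Proof. by rewrite /rotation mulr0 cos0 sin0. Qed.

Lemma rotationX w k : rotation w ^+ k = rotation (w * k%:R).
Proof.
elim: k => [|k IHk]; first by rewrite mulr0 rotation0.
by rewrite exprSr IHk -rotationD mulrSr mulrDr mulr1.
Qed.

Lemma conj_rotation w : conjc (rotation w) = rotation (- w).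
Proof. by rewrite /rotation mulrN cosN sinN. Qed.

Lemma rotation_neq0 w : rotation w != 0.
Proof.
have := rotationD w (- w); rewrite addrN rotation0.
by apply: contra_eq_neq => ->; rewrite mul0r oner_eq0.
Qed.

Lemma conj_rotationV w : conjc (rotation w) = (rotation w)^-1.
Proof.
apply: (mulIf (rotation_neq0 w)); rewrite mulVf ?rotation_neq0 //.
by rewrite conj_rotation -rotationD addNr rotation0.
Qed.

(** Only the fractional part [t] of [w] matters. From [cos (2 pi t) = 1] follows [sin (pi t) = 0],
    while the sine is positive strictly between 0 and [pi]; hence [t = 0]. *)
Lemma rotation_eq1 w : rotation w = 1 -> exists m : int, w = m%:~R.
Proof.
have rot_int (m : int) : rotation (- m%:~R : R) = 1.
  have rot1 : rotation (1 : R) = 1.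
    by rewrite /rotation mulr1 mulr_natl cos2pi sin2pi.
  have rotN : rotation (-1 : R) = 1.
    have := rotationD 1 (- 1 : R).
    by rewrite addrN rotation0 rot1 mul1r => <-.
  case: m => k.
    have -> : - (Posz k)%:~R = -1 * k%:R :> R by rewrite mulN1r.
    by rewrite -rotationX rotN expr1n.
  have -> : - (Negz k)%:~R = 1 * k.+1%:R :> R by rewrite NegzE rmorphN opprK mul1r.
  by rewrite -rotationX rot1 expr1n.
move=> rot_w; exists (Num.floor w); set m := Num.floor w.
pose t := w - m%:~R; have t_itv : 0 <= t < 1.
  have /andP[le_m lt_m] := floor_itv w.
  by rewrite /t; move: le_m lt_m; rewrite -/m rmorphD /=; lra.
have rot_t : rotation t = 1 by rewrite rotationD rot_int mulr1.
have cos_t : cos (pi * t *+ 2) = 1.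
  rewrite -mulr_natl mulrA.
  by have := congr1 (@complex.Re R) rot_t.
have sin_t : sin (pi * t) = 0.
  move: cos_t; rewrite cos_mulr2n => c2.
  have := cos2Dsin2 (pi * t); rewrite -mulr_natl in c2 *.
  move=> cs; apply/eqP; rewrite -sqrf_eq0; apply/eqP; lra.
apply/eqP; rewrite -subr_eq0 -/t; apply/eqP.
have [//|t_neq0] := eqVneq t 0.
have t_gt0 : 0 < t by lra.
have : 0 < sin (pi * t).
  apply: sin_gt0_pi; rewrite mulr_gt0 ?pi_gt0 //= gtr_pMr ?pi_gt0 //.
  by case/andP: t_itv.
by rewrite sin_t ltxx.
Qed.

Lemma rotationX_eq1 w k : irrational w -> rotation w ^+ k = 1 -> k = 0%N.
Proof.
rewrite rotationX => w_irr /rotation_eq1[m wk_eq].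
apply/eqP; apply: contra_notT w_irr => k_neq0.
exists (m%:~R / k%:R) => //; rewrite fmorph_div rmorph_int rmorph_nat -wk_eq mulfK //.
by rewrite pnatr_eq0.
Qed.

(** This is the nonresonance hypothesis of [conjugacy_support_step], with [mu] the inverse of
    [lam]. *)
Lemma rotation_resonance w p q : irrational w ->
  rotation w ^+ p * (rotation w)^-1 ^+ q = rotation w -> p = q.+1.
Proof.
move=> w_irr.
have rotX_neq0 m : rotation w ^+ m != 0 by rewrite expf_neq0 ?rotation_neq0.
rewrite exprVn => /(canRL (mulfVK (rotX_neq0 q))); rewrite -exprS => eq_pq.
have [le_pq|lt_qp] := leqP p q.+1.
  move: eq_pq; rewrite -(subnKC le_pq) exprD -{1}[_ ^+ p]mulr1.
  by move=> /(mulfI (rotX_neq0 p))/esym/(rotationX_eq1 w_irr); lia.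
move: eq_pq; rewrite -(subnKC (ltnW lt_qp)) exprD -{2}[_ ^+ q.+1]mulr1.
by move=> /(mulfI (rotX_neq0 _))/(rotationX_eq1 w_irr); lia.
Qed.

End Rotation.

(** * The factor of [F] next to [lam z] *)

Section UnitPart.
Variable R : realType.
Local Notation C := R[i].
Local Notation ps2 := (fps1 (fps1 C)).

Lemma geometric_growth1 : geometric_growth (1 : fps1 C).
Proof.
exists 1, 1; split=> // n; rewrite expr1n mulr1.
by case: n => [|n]; rewrite ?Normc.normc1 ?Normc.normc0.
Qed.

Lemma geometric_growth_psX : geometric_growth (psX C).
Proof.
exists 1, 1; split=> // n; rewrite expr1n mulr1 /psX.
by case: eqP => _; rewrite ?Normc.normc1 ?Normc.normc0.
Qed.

Lemma geometric_growthX (a : fps1 C) k :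
  geometric_growth a -> geometric_growth (a ^+ k).
Proof.
move=> Ha; elim: k => [|k IHk]; first exact: geometric_growth1.
by rewrite exprS; exact: geometric_growthM.
Qed.

(** The condition on [p] in [g_face] reads [2 p = k (M + n)], which has one solution or none
    according to parity. *)
Lemma g_faceE (n M : nat) (g : ps2) : (n <= M)%N -> g 0%N 0%N = 0 ->
  g_face n%:Z M g = face n M g.
Proof.
move=> le_nM g0; apply/funext => k; rewrite /g_face /face.
case: (k =P 0%N) => [->|_]; first by rewrite !mul0n g0.
have odd_eq : odd (k * (M - n)) = odd (k * (M + n)).
  by rewrite !oddM oddB // oddD.
have le_kn : (k * n <= k * M)%N by rewrite leq_mul2l le_nM orbT.
have mulB := mulnBr k M n; have mulD := mulnDr k M n.
case: ifPn => [odd_k|even_k].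
  rewrite big_pred0 // => p; apply/negbTE/eqP => eq_p.
  have le_p := leq_ord p.
  have : (p.*2 = k * (M + n))%N by lia.
  by move=> dp; rewrite -dp odd_double in odd_k.
have lt_p : ((k * (M + n))./2 < (k * M).+1)%N by lia.
rewrite (big_pred1 (Ordinal lt_p)) /= => [|p].
  by congr (g _ _); lia.
apply/eqP/eqP => [eq_p | ->]; last by rewrite /=; lia.
by apply: val_inj => /=; have := leq_ord p; lia.
Qed.

(** [x] is a parameter because [F] has this factor with [x = 2 pi i] and, [f] and [g] being real,
    the conjugate of [F] has it with the opposite [x]. *)
Definition unit_part (f : fps1 C) (g : ps2) (x : C) : ps2 :=
  (1 + (of_sqmod f : ps2)) * (exp2 (scale2 x g) : ps2).

Lemma mapFE lam (f : fps1 R) g :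
  mapF lam f g = rescaleX lam (unit_part (fun n => (f n)%:C%C) g (two_pi_i R)).
Proof.
rewrite /mapF /rescaleX /unit_part scale2E !mul2E varzE add2E one2E.
by rewrite -[psX _ * _ * _]mulrA.
Qed.

Lemma conj_unit_part (f : fps1 R) (g : ps2) : (forall j k, g k j = conjc (g j k)) ->
  conj_fps2 (unit_part (fun n => (f n)%:C%C) g (two_pi_i R)) =
  unit_part (fun n => (f n)%:C%C) g (- two_pi_i R).
Proof.
move=> g_real; rewrite /unit_part conj_fps2M conj_fps2D conj_fps2_1.
rewrite conj_exp2 conj_scale2.
have -> : conj_fps2 g = g.
  by apply/funext => p; apply/funext => q; rewrite /conj_fps2 -g_real.
have -> : conjc (two_pi_i R) = - two_pi_i R.
  by apply/eqP; rewrite /two_pi_i eq_complex /= oppr0 !eqxx.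
have -> // : conj_fps2 (of_sqmod (fun n => (f n)%:C%C)) = of_sqmod (fun n => (f n)%:C%C).
apply/funext => p; apply/funext => q.
rewrite /conj_fps2 /of_sqmod eq_sym; case: (p =P q) => [->|_]; last exact: rmorph0.
by apply/eqP; rewrite eq_complex /= oppr0 !eqxx.
Qed.

Lemma unit_part00 f g x : f 0%N = 0 -> unit_part f g x 0%N 0%N = 1.
Proof.
move=> f0; rewrite /unit_part coef0_psM coef0_psM exp2_00 mulr1.
by rewrite coef_psD coef_psD /of_sqmod eqxx f0 addr0.
Qed.

Lemma weight_ge_unit_part (u v : int) f g x d : 0 <= u + v ->
  weight_ge u v 0 d g -> weight_ge u v 0 d (unit_part f g x).
Proof.
move=> uv_ge0 wg; rewrite -[0 in X in weight_ge _ _ X]addr0.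
apply: weight_geM; last exact/weight_ge_exp2/weight_ge_scale.
by apply: weight_geD; [exact: weight_ge1 | exact: weight_ge_sqmod].
Qed.

Lemma face_unit_part (n M : nat) f g x :
  (0 < n)%N -> (n <= M)%N -> coprime n M -> f 0%N = 0 -> g 0%N 0%N = 0 ->
  (forall d, weight_ge (n%:Z - M%:Z) (n%:Z + M%:Z) 0 d g) ->
  face n M (unit_part f g x) = exp1 (scale1 x (face n M g)).
Proof.
move=> n_gt0 le_nM co_nM f0 g0 wg.
have uv_ge0 : 0 <= (n%:Z - M%:Z) + (n%:Z + M%:Z) by lia.
rewrite /unit_part faceM // => [|d|d]; last exact/weight_ge_exp2/weight_ge_scale.
  rewrite faceD face1 // face_sqmod // addr0 mul1r face_exp2 // => [|d|].
  - by rewrite face_scale.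
  - exact: weight_ge_scale.
  - by rewrite /scale2 g0 mulr0.
by apply: weight_geD; [exact: weight_ge1 | exact: weight_ge_sqmod].
Qed.

End UnitPart.

(** * Slopes of [g] and their supremum *)

Lemma slopes_weight (R : realType) (g : fps2 R[i]) (n M : nat) :
  (0 < M)%N -> g 0%N 0%N = 0 -> (forall x, slopes g x -> x <= n%:R / M%:R) ->
  forall d, weight_ge (n%:Z - M%:Z) (n%:Z + M%:Z) 0 d g.
Proof.
move=> M_gt0 g0 Hg d p q _ nz.
have pq_gt0 : (0 < p + q)%N.
  rewrite lt0n; apply: contra nz; rewrite addn_eq0 => /andP[/eqP-> /eqP->].
  exact/eqP.
have : (p%:R - q%:R) / (p%:R + q%:R) <= n%:R / M%:R :> R by apply: Hg; exists p, q.
(* Cleared of denominators, the slope bound is [M (p - q) <= n (p + q)], that is, nonnegative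
   weight. *)
rewrite ler_pdivrMr ?ler_pdivlMr -?natrD ?ltr0n // mulrAC ler_pdivlMr ?ltr0n //.
have -> : (p%:R - q%:R) * M%:R = ((p%:Z - q%:Z) * M%:Z)%:~R :> R.
  by rewrite rmorphM rmorphB.
have -> : n%:R * (p + q)%:R = (n%:Z * (p + q)%:Z)%:~R :> R by rewrite rmorphM.
by rewrite ler_int; lia.
Qed.

(** Reality of [g] makes the set of slopes symmetric about 0, so its supremum is nonnegative. Being
    nonempty and bounded by 1, the set has a genuine supremum. *)
Lemma slopes_sup_bounds (R : realType) (g : fps2 R[i]) :
  (exists j k, g j k != 0) -> (forall j k, g k j = conjc (g j k)) ->
  [/\ forall x, slopes g x -> x <= sup (slopes g), 0 <= sup (slopes g) &
      sup (slopes g) <= 1].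
Proof.
move=> [j [k njk]] g_real.
have ub1 : ubound (slopes g) 1.
  move=> x [p [q [_ ->]]].
  have p0 : 0 <= p%:R :> R by []. have q0 : 0 <= q%:R :> R by [].
  have [->|pq_neq0] := eqVneq (p%:R + q%:R : R) 0; first by rewrite invr0 mulr0.
  by rewrite ler_pdivrMr; lra.
have sl : slopes g ((j%:R - k%:R) / (j%:R + k%:R)) by exists j, k.
have sl' : slopes g ((k%:R - j%:R) / (k%:R + j%:R)).
  by exists k, j; split=> //; rewrite g_real conjc_eq0.
have hs : has_sup (slopes g) by split; [eexists; exact: sl | exists 1].
have le_sup x : slopes g x -> x <= sup (slopes g) by exact: sup_upper_bound.
split=> //; last by apply: ge_sup => //; eexists; exact: sl.
have := le_sup _ sl; have := le_sup _ sl'.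
have -> : (k%:R - j%:R) / (k%:R + j%:R) = - ((j%:R - k%:R) / (j%:R + k%:R)) :> R.
  by rewrite -mulNr opprB (addrC j%:R).
lra.
Qed.

Theorem theorem28 (R : realType) (omega : R) (f : fps1 R) (g : fps2 R[i])
    (N : int) (M : nat)
    (omega_irrational : irrational omega)
    (f_0 : f 0%N = 0)
    (f_analytic : converges1 (fun n => real_complex R (f n)))
    (g_00 : g 0%N 0%N = 0)
    (g_analytic : converges2 g)
    (g_real : forall j k : nat, g k j = conjc (g j k))
    (g_neq0 : exists j k : nat, g j k != 0)
    (M_gt0 : (0 < M)%N)
    (NM_irreducible : coprime `|N|%N M)
    (rho_eq : sup (slopes g) = N%:~R / M%:R)
    (F0_not_linearizable :
       ~ holomorphically_linearizable (mapF0 (rotation omega) N M g))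
    (alpha : fps1 R[i]) (alpha_0 : alpha 0%N = 0)
    (Psi : fps2 R[i])
    (Psi_conj : formal_conjugacy (mapF (rotation omega) f g)
                  (rotation omega) alpha Psi) :
  divergent Psi.
Proof.
move=> Psi_conv; apply: F0_not_linearizable.
have [le_sup sup_ge0 sup_le1] := slopes_sup_bounds g_neq0 g_real.
have MR_gt0 : 0 < M%:R :> R by rewrite ltr0n.
(* The supremum is nonnegative, hence so is [N], which is replaced by a natural number. *)
have [n N_eq] : exists n : nat, N = n%:Z.
  move: sup_ge0; rewrite rho_eq pmulr_lge0 ?invr_gt0 // ler0z.
  by case: (N) => // n _; exists n.
rewrite N_eq in rho_eq NM_irreducible *.
have le_nM : (n <= M)%N.
  by move: sup_le1; rewrite rho_eq ler_pdivrMr // mul1r -(ler_nat R).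
move: NM_irreducible => /= co_nM.
(* For [N = 0] the germ [F0] is [Z], linearized by [h = Z]. *)
have [n_eq0|n_gt0] := posnP n.
  rewrite n_eq0 /mapF0 mulr0 exp1_scale0 scale1E mul1E varZE mulr1.
  have -> : psC (rotation omega ^ 0%N) = 1 by apply/funext => -[].
  rewrite mul1r; exists (psX _); split=> //.
  - exact/geometric_growth_converges/geometric_growth_psX.
  - by rewrite comp1_X // scale1E => i; rewrite coef_psCM mul1r.
case: Psi_conj => -[Psi00 Psi10 Psi01] conj_eq.
set lam := rotation omega in conj_eq *.
pose fC : fps1 R[i] := fun n => (f n)%:C%C.
have fC0 : fC 0%N = 0 by rewrite /fC f_0.
pose U := unit_part fC g (two_pi_i R); pose V := unit_part fC g (- two_pi_i R).
pose Psib : fps1 (fps1 R[i]) := conj_fps2 Psi.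
have Psib00 : Psib 0%N 0%N = 0 by rewrite /Psib /conj_fps2 Psi00 conjc0.
have {}conj_eq : subst2 Psi (rescaleX lam U) (rescaleY lam^-1 V) =2
    subst2 (normal_form2 lam alpha) Psi Psib.
  have FE : mapF lam f g = rescaleX lam U by exact: mapFE.
  have conjFE : conj_fps2 (mapF lam f g) = rescaleY lam^-1 V.
    by rewrite FE conj_rescaleX conj_rotationV conj_unit_part.
  by move: conj_eq; rewrite /comp2 conjFE FE.
pose u : int := n%:Z - M%:Z; pose v : int := n%:Z + M%:Z.
have wg : forall d, weight_ge u v 0 d g.
  by apply: slopes_weight => // x /le_sup; rewrite rho_eq.
(* [g] is real, so its support is symmetric and the exchanged weight is nonnegative on it too. *)
have wg' : forall d, weight_ge v u 0 d g.
  have conj_g : conj_fps2 g = g.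
    by apply/funext => p; apply/funext => q; rewrite /conj_fps2 -g_real.
  by move=> d; rewrite -conj_g; apply: weight_ge_conj.
have uv_ge0 : 0 <= u + v by rewrite /u /v; lia.
have wU d : weight_ge u v 0 d U by exact: weight_ge_unit_part.
have wV d : weight_ge u v 0 d V by exact: weight_ge_unit_part.
have [wPsi wPsi'] : (forall d, weight_ge u v u d Psi) /\
                    (forall d, weight_ge v u v d Psi).
  (* Both weights advance together: the bound on [Psib] needed for one is the conjugate of the bound
     on [Psi] for the other. *)
  have wPsi2 d : weight_ge u v u d Psi /\ weight_ge v u v d Psi.
    elim: d => [|d [IH1 IH2]]; first by split.
    have nonres p q : lam ^+ p * lam^-1 ^+ q = lam -> p = q.+1.
      exact: rotation_resonance.
    have U0 : U 0%N 0%N = 1 by exact: unit_part00.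
    have V0 : V 0%N 0%N = 1 by exact: unit_part00.
    split.
      apply: (conjugacy_support_step _ alpha_0 Psi00 Psib00 U0 V0 _ _
               conj_eq nonres) => //.
      exact: weight_ge_conj.
    apply: (conjugacy_support_step _ alpha_0 Psi00 Psib00 U0 V0 _ _
               conj_eq nonres) => //.
    - by rewrite addrC.
    - by move=> d'; apply: weight_ge_unit_part => //; rewrite addrC.
    - by move=> d'; apply: weight_ge_unit_part => //; rewrite addrC.
    - exact: weight_ge_conj.
  by split=> d; case: (wPsi2 d).
have wPsib d : weight_ge u v v d Psib by exact: weight_ge_conj.
pose g0 := face n M g; have g0_0 : g0 0%N = 0 by rewrite /g0 /face !mul0n g_00.
pose E := exp1 (scale1 (two_pi_i R) g0).
have E0 : E 0%N = 1 by rewrite /E /exp1 big_ord1 fact0 invr1 mul1r.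
(* Lowering the exponent of [z] by one brings the least weight [u] to 0, and the constant term of
   [P] is [Psi 1 0 = 1]. *)
pose P := face n M (fun p => Psi p.+1).
have P0 : P 0%N = 1 by rewrite /P /face !mul0n.
have PE : E * comp1 P (scale1 (lam ^+ n) (psX _ * E ^+ n)) = P.
  apply: (face_identity n_gt0 le_nM co_nM alpha_0 Psi00 Psib00 _ wU wV
            wPsi wPsib conj_eq).
  - exact: rotation_neq0.
  - exact: face_unit_part.
  - by rewrite /V face_unit_part // -exp1_scaleD // addrN exp1_scale0.
have [h0 h1 h_lin] := linearization P0 E0 PE.
exists (psX _ * P ^+ n); split=> //.
  apply/geometric_growth_converges/geometric_growthM/geometric_growthX.
    exact: geometric_growth_psX.
  (* With the shift, the degree on the face is [k M + 1], at most [M (k + 1)]. *)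
  apply: (@geometric_growth_subseries _ M Psi (fun k => (k * (M + n))./2.+1)
            (fun k => (k * (M - n))./2)) => // k.
    have : (k * n <= k * M)%N by rewrite leq_mul2l le_nM orbT.
    by rewrite mulnDr mulnBr mulnS; lia.
  by rewrite /P /face; case: ifP; [left | right].
(* [E ^+ n] is [e^(2 pi i n g0)], the exponential factor of [F0]. *)
have -> : mapF0 lam n%:Z M g = scale1 (lam ^+ n) (psX _ * E ^+ n).
  by rewrite /mapF0 mul1E varZE g_faceE // exp1_scaleMn.
by [].
Qed.
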